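(* For any symmetric measurable cost function $\beta\ge0$, $$\mathbf E\,S=2\iint_{0<u<t<1}\beta(u,t)\,\bigl[(\alpha\vee t)-(\alpha\wedge u)\bigr]^{-1}\,du\,dt$$ (as an equality in $[0,\infty]$).
   Context: Fix $\alpha\in[0,1]$ and a symmetric measurable cost function $\beta:(0,1)\times(0,1)\to[0,\infty)$. Here $a\vee b=\max(a,b)$, $a\wedge b=\min(a,b)$. Let $U_1,U_2,\dots$ be i.i.d. uniform$(0,1)$ random variables. Put $L_0:=0$, $R_0:=1$ and, inductively for $k\ge 1$, $$\tau_k:=\inf\{i:\ L_{k-1}<U_i<R_{k-1}\},$$ $$L_k:=\mathbf 1(U_{\tau_k}<\alpha)\,U_{\tau_k}+\mathbf 1(U_{\tau_k}>\alpha)\,L_{k-1},\qquad R_k:=\mathbf 1(U_{\tau_k}<\alpha)\,R_{k-1}+\mathbf 1(U_{\tau_k}>\alpha)\,U_{\tau_k}.$$ (Almost surely all $\tau_k$ are finite and no $U_i$ equals $\alpha$.) Further, $$I_k:=\int_{L_{k-1}}^{R_{k-1}}\beta(u,U_{\tau_k})\,du,\qquad S:=\sum_{k\ge1}I_k .$$ *)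

(* Defs.v *)
From HB Require Import structures.
From mathcomp Require Import all_boot all_order all_algebra.
From mathcomp Require Import all_classical all_reals all_analysis.
Set Implicit Arguments.
Unset Strict Implicit.
Unset Printing Implicit Defensive.
Import Order.TTheory GRing.Theory Num.Theory.
Import numFieldNormedType.Exports.
Local Open Scope classical_set_scope.
Local Open Scope ring_scope.

Definition mutually_independent d (T : measurableType d) (R : realType)
    (P : probability T R) (X : nat -> {RV P >-> R}) : Prop :=
  forall (J : seq nat) (A : nat -> set R), uniq J ->
    (forall i, measurable (A i)) ->
    P (\bigcap_(i in [set` J]) (X i @^-1` A i)) =
    (\prod_(i <- J) P (X i @^-1` A i))%E.

(* The law is compared on Borel sets only: both sides are also defined, with
   meaningless values, on non-measurable sets. *)
Definition uniform01 d (T : measurableType d) (R : realType)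
    (P : probability T R) (X : {RV P >-> R}) : Prop :=
  forall A : set R, measurable A ->
    distribution P X A = uniform_prob (@ltr01 R) A.

(* Below, u is a realization of the sample, u i being U_(i+1).  *)

(* inf {i | l < u i < r}, with None standing for inf set0 = +oo. *)
Definition first_between (R : realType) (u : nat -> R) (l r : R) : option nat :=
  if pselect (exists i, l < u i < r) is left h then Some (ex_minn h) else None.

(* If no sample point falls in ]L, R[ (a null event) the process stops. *)
Definition qstep (R : realType) (alpha : R) (u : nat -> R) (lr : R * R) : R * R :=
  let: (l, r) := lr in
  if first_between u l r is Some i then
    ((u i < alpha)%R%:R * u i + (alpha < u i)%R%:R * l,
     (u i < alpha)%R%:R * r + (alpha < u i)%R%:R * u i)
  else (l, r).

Definition left_end (R : realType) (alpha : R) (u : nat -> R) (k : nat) : R :=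
  (iter k (qstep alpha u) (0, 1)).1.

Definition right_end (R : realType) (alpha : R) (u : nat -> R) (k : nat) : R :=
  (iter k (qstep alpha u) (0, 1)).2.

(* tau and round_cost are meant for k >= 1. *)
Definition tau (R : realType) (alpha : R) (u : nat -> R) (k : nat) : option nat :=
  first_between u (left_end alpha u k.-1) (right_end alpha u k.-1).

Definition round_cost (R : realType) (alpha : R) (beta : R -> R -> R)
    (u : nat -> R) (k : nat) : \bar R :=
  if tau alpha u k is Some i then
    (\int[lebesgue_measure]_(x in
        `](left_end alpha u k.-1), (right_end alpha u k.-1)[) (beta x (u i))%:E)%E
  else 0%E.

Definition total_cost (R : realType) (alpha : R) (beta : R -> R -> R)
    (u : nat -> R) : \bar R :=
  (\sum_(1 <= k <oo) round_cost alpha beta u k)%E.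

(* Main.v *)
(**
Index the cost by sample points instead of by rounds. Before the n-th point is
read the current interval is ]A, B[, where A is the largest earlier point below
alpha and B the smallest earlier point above alpha; hence, when no point equals
alpha, S is the sum over n of the integral of beta(x, U_n) over x in ]A, B[,
counted only if U_n falls in ]A, B[. Since ]A, B[ is independent of U_n,
the expectation of the n-th term is the double integral of
beta(x, t) P(x and t lie in ]A, B[). Both x and t lie in ]A, B[ iff no earlier
point hit the hull of {alpha, x, t} (up to endpoints), whose length is p(x, t),
so this probability is (1 - p)^n. The geometric series sums to 1/p, and
symmetry of beta gives the factor 2.
*)
Require Import Defs.
From HB Require Import structures.
From mathcomp Require Import all_boot all_order all_algebra.
From mathcomp Require Import all_classical all_reals all_analysis measurable_realfun.
Import Order.TTheory GRing.Theory Num.Theory.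
Import numFieldNormedType.Exports.
Local Open Scope classical_set_scope.
Local Open Scope ring_scope.

(** * Rounds versus sample points *)

(** This keeps every interval of integration inside the unit interval, the only place where [beta]
    is known to be nonnegative. *)
Lemma state_itv {R : realType} (alpha : R) (u : nat -> R) k :
  0 <= left_end alpha u k /\ right_end alpha u k <= 1.
Proof.
rewrite /left_end /right_end; elim: k => [|k] /=; first by rewrite !lexx.
case: (iter k _ _) => l r /= [l0 r1].
case fE : first_between => [m|//] /=.
move: fE; rewrite /first_between; case: pselect => // h [<-].
case: ex_minnP => {}m /andP[lu ur] _.
case: (ltgtP (u m) alpha) => _ /=; rewrite ?mul1r ?mul0r ?addr0 ?add0r;
  split => //.
- exact: le_trans (ltW lu).
- exact: le_trans (ltW ur) r1.
Qed.

Lemma round_cost_ge0 {R : realType} (alpha : R) (beta : R -> R -> R) u k :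
  (forall x y, 0 < x < 1 -> 0 < y < 1 -> 0 <= beta x y) ->
  (0 <= round_cost alpha beta u k)%E.
Proof.
move=> beta_ge0; rewrite /round_cost /tau.
have [l0 r1] := state_itv alpha u k.-1.
case fE : first_between => [m|//].
move: fE; rewrite /first_between; case: pselect => // h [<-].
case: ex_minnP => {}m /andP[lu ur] _.
apply: integral_ge0 => x /=; rewrite in_itv /= lee_fin => /andP[lx xr].
by apply: beta_ge0; rewrite ?(le_lt_trans l0) ?(lt_le_trans _ r1).
Qed.

(** * Running extremes of the sample on either side of [alpha] *)

Section running_extremes.
Context {R : realType} (alpha : R).

(** [below] and [above] replace irrelevant values by 0 and 1, the initial values of the running
    maximum and minimum. The value [alpha] itself moves neither extreme. *)
Definition below (x : R) : R := if 0 < x < alpha then x else 0.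
Definition above (x : R) : R := if alpha < x < 1 then x else 1.

Fixpoint lo (u : nat -> R) (n : nat) : R :=
  if n is m.+1 then Num.max (lo u m) (below (u m)) else 0.

Fixpoint hi (u : nat -> R) (n : nat) : R :=
  if n is m.+1 then Num.min (hi u m) (above (u m)) else 1.

(** The extremes at time [n] involve only indices below [n], so the interval is the one in force
    just before [u n] is read. *)
Definition time_cost (beta : R -> R -> R) (u : nat -> R) (n : nat) : \bar R :=
  if lo u n < u n < hi u n then
    (\int[lebesgue_measure]_(x in `](lo u n), (hi u n)[) (beta x (u n))%:E)%E
  else 0%E.

Hypothesis alpha01 : 0 <= alpha <= 1.

Lemma lo_itv u n : 0 <= lo u n <= alpha.
Proof.
case/andP: alpha01 => a0 a1.
elim: n => [|n /andP[l0 la]] /=; first by rewrite lexx a0.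
rewrite le_max l0 /= ge_max la /= /below.
by case: ifPn => // /andP[_ /ltW].
Qed.

Lemma hi_itv u n : alpha <= hi u n <= 1.
Proof.
case/andP: alpha01 => a0 a1.
elim: n => [|n /andP[l0 la]] /=; first by rewrite lexx a1.
rewrite ge_min la /= le_min l0 /= andbT /above.
by case: ifPn => // /andP[/ltW].
Qed.

Context (u : nat -> R).

(** The right-hand side copies the update in [qstep]. A hit lies in ]0, 1[, so it is not replaced,
    and it beats the old extreme on its side of [alpha]. *)
Lemma lo_hi_hit n : lo u n < u n < hi u n -> u n != alpha ->
  (lo u n.+1, hi u n.+1) =
  ((u n < alpha)%R%:R * u n + (alpha < u n)%R%:R * lo u n,
   (u n < alpha)%R%:R * hi u n + (alpha < u n)%R%:R * u n).
Proof.
have /andP[l0 la] := lo_itv u n; have /andP[ah h1] := hi_itv u n.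
move=> /andP[lu uh] una /=; rewrite /below /above.
have u0 : 0 < u n by exact: le_lt_trans lu.
have u1 : u n < 1 by exact: lt_le_trans h1.
move: una; rewrite neq_lt u0 u1 /= andbT => /orP[ua|au].
  rewrite ua (lt_gtF ua) /= !mul1r !mul0r !addr0.
  by rewrite (max_idPr (ltW lu)) (min_idPl h1).
rewrite au (lt_gtF au) /= !mul1r !mul0r !add0r.
by rewrite (max_idPl l0) (min_idPr (ltW uh)).
Qed.

(** A point of ]0, alpha[ is below [hi], so it can miss only by being at most [lo], and then the
    maximum ignores it. The other side is symmetric. *)
Lemma lo_hi_miss n : ~~ (lo u n < u n < hi u n) ->
  lo u n.+1 = lo u n /\ hi u n.+1 = hi u n.
Proof.
have /andP[l0 la] := lo_itv u n; have /andP[ah h1] := hi_itv u n.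
rewrite negb_and -!leNgt /= /below /above => miss.
split.
  case: ifPn => [/andP[u0 ua]|_]; apply/max_idPl => //.
  by case/orP: miss => // hu; move: (le_lt_trans hu ua); rewrite ltNge ah.
case: ifPn => [/andP[au u1]|_]; apply/min_idPl => //.
by case/orP: miss => // ul; move: (lt_le_trans au ul); rewrite ltNge la.
Qed.

(** Once read, a point of ]0, 1[ other than [alpha] bounds the extreme on its side, and later
    intervals only shrink. Hence the infimum over all indices in [tau] never returns to the past. *)
Lemma past_outside m n : (forall i, u i != alpha) ->
  lo u n < u m < hi u n -> (n <= m)%N.
Proof.
move=> ua; rewrite leqNgt; apply: contraTN.
elim: n => // n IH; rewrite ltnS leq_eqVlt => /predU1P[->|/IH].
  apply/negP => /andP[] /=; rewrite gt_max lt_min /below /above.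
  move=> /andP[lu +] /andP[uh +].
  have u0 : 0 < u n by apply: le_lt_trans lu; case/andP: (lo_itv u n).
  have u1 : u n < 1 by apply: lt_le_trans uh _; case/andP: (hi_itv u n).
  have := ua n; rewrite u0 u1 neq_lt /= andbT.
  by case: (u n < alpha) => /=; [rewrite ltxx|move=> ->; rewrite ltxx].
apply: contraNN => /andP[] /=; rewrite gt_max lt_min.
by move=> /andP[-> _] /andP[-> _].
Qed.

Lemma time_cost_ge0 (beta : R -> R -> R) n :
  (forall x y, 0 < x < 1 -> 0 < y < 1 -> 0 <= beta x y) ->
  (0 <= time_cost beta u n)%E.
Proof.
move=> beta_ge0; rewrite /time_cost; case: ifPn => // /andP[lu uh].
have /andP[l0 _] := lo_itv u n; have /andP[_ h1] := hi_itv u n.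
apply: integral_ge0 => x /=; rewrite in_itv /= lee_fin => /andP[lx xh].
by apply: beta_ge0; rewrite ?(le_lt_trans l0) ?(lt_le_trans _ h1).
Qed.

End running_extremes.

(** * Matching rounds with the sample points that hit *)

Section reindexing.
Context {R : realType} (alpha : R) (beta : R -> R -> R) (u : nat -> R).
Hypotheses (alpha01 : 0 <= alpha <= 1) (ua : forall i, u i != alpha).

Let state K := iter K (qstep alpha u) (0, 1).

(* Every n is synced with some K and every K with some n, so that each of the
   two series dominates the partial sums of the other. *)
Let synced n K := state K = (lo alpha u n, hi alpha u n) /\
  (\sum_(1 <= k < K.+1) round_cost alpha beta u k =
   \sum_(0 <= i < n) time_cost alpha beta u i)%E.

Let synced0 : synced 0 0.
Proof. by split => //; rewrite !big_geq. Qed.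

Let synced_miss n K : ~~ (lo alpha u n < u n < hi alpha u n) ->
  synced n K -> synced n.+1 K.
Proof.
move=> miss [sE cE]; rewrite /synced.
have [-> ->] := lo_hi_miss alpha alpha01 u n miss.
by split => //; rewrite cE big_nat_recr //= /time_cost (negbTE miss) adde0.
Qed.

Let synced_hit n K : lo alpha u n < u n < hi alpha u n ->
  synced n K -> synced n.+1 K.+1.
Proof.
move=> hit [sE cE].
(* No earlier index qualifies, so the search over all indices stops exactly at [n]. *)
have fE : first_between u (lo alpha u n) (hi alpha u n) = Some n.
  rewrite /first_between; case: pselect => [h|[]]; last by exists n.
  congr Some; case: ex_minnP => m mP minm.
  by apply/anti_leq; rewrite minm //= (past_outside _ alpha01 _ _ _ ua mP).
split.
  by rewrite /state iterS -/(state K) sE /= fE lo_hi_hit.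
rewrite big_nat_recr //= cE [RHS]big_nat_recr //=; congr (_ + _)%E.
by rewrite /round_cost /tau /left_end /right_end /= -/(state K) sE /= fE
   /time_cost hit.
Qed.

Let synced_time n : exists K, synced n K.
Proof.
elim: n => [|n [K nK]]; first by exists 0%N.
have [hit|miss] := boolP (lo alpha u n < u n < hi alpha u n).
  by exists K.+1; exact: synced_hit.
by exists K; exact: synced_miss.
Qed.

(** Either no point ever hits, and the next round leaves the state as it is at zero cost, or the
    first hit has an index [m] with n <= m. The points from [n] up to [m] miss, so [n] advances to
    [m] with [K] fixed, and reading point [m] completes the round. *)
Let synced_round K : exists n, synced n K.
Proof.
elim: K => [|K [n nK]]; first by exists 0%N.
have [sE cE] := nK.
case fE : (first_between u (lo alpha u n) (hi alpha u n)) => [m|]; last first.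
  exists n; split; first by rewrite /state iterS -/(state K) sE /= fE.
  rewrite big_nat_recr //= cE.
  by rewrite /round_cost /tau /left_end /right_end /= -/(state K) sE /= fE adde0.
move: fE; rewrite /first_between; case: pselect => // h _.
case: (ex_minnP h) => {h}{}m mP minm.
have nm := past_outside _ alpha01 _ _ _ ua mP.
have skip k : (n + k <= m)%N -> synced (n + k) K /\
   lo alpha u (n + k) = lo alpha u n /\ hi alpha u (n + k) = hi alpha u n.
  elim: k => [|k IH] nkm; first by rewrite addn0.
  rewrite addnS in nkm *; have [nkK [lE hE]] := IH (ltnW nkm).
  have miss : ~~ (lo alpha u (n + k) < u (n + k)%N < hi alpha u (n + k)).
    by rewrite lE hE; apply/negP => /minm; rewrite leqNgt nkm.
  split; first exact: synced_miss.
  by have [-> ->] := lo_hi_miss alpha alpha01 u _ miss.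
have := skip (m - n)%N; rewrite subnKC // => /(_ (leqnn m)) [mK [lE hE]].
by exists m.+1; apply: synced_hit => //; rewrite lE hE.
Qed.

Lemma total_cost_time : (forall x y, 0 < x < 1 -> 0 < y < 1 -> 0 <= beta x y) ->
  total_cost alpha beta u = (\sum_(0 <= i <oo) time_cost alpha beta u i)%E.
Proof.
move=> beta_ge0.
have tc0 i := time_cost_ge0 alpha alpha01 u beta i beta_ge0.
have rc0 k := round_cost_ge0 alpha beta u k beta_ge0.
apply/eqP; rewrite eq_le; apply/andP; split.
- apply: lime_le; first by apply: is_cvg_nneseries => k k1 _; exact: rc0.
  (* Rounds are numbered from 1: the sum with upper limit 0 is empty, and the others have the form
     [K.+1] used in [synced]. *)
  apply: nearW => -[|K]; first by rewrite big_geq // nneseries_ge0.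
  have [n [_ ->]] := synced_round K.
  exact: nneseries_lim_ge.
- apply: lime_le; first by apply: is_cvg_nneseries => k k1 _; exact: tc0.
  apply: nearW => n; have [K [_ <-]] := synced_time n.
  by apply: nneseries_lim_ge => k k1 _; exact: rc0.
Qed.

End reindexing.

(** * Independence of the past *)

Lemma measurable_below {R : realType} (alpha : R) :
  measurable_fun setT (below alpha).
Proof.
apply: measurable_fun_ifT => //.
by apply: measurable_and; exact: measurable_fun_ltr.
Qed.

Lemma measurable_above {R : realType} (alpha : R) :
  measurable_fun setT (above alpha).
Proof.
apply: measurable_fun_ifT => //.
by apply: measurable_and; exact: measurable_fun_ltr.
Qed.

Section past_independence.
Context {R : realType} {d : measure_display} {T : measurableType d}.
Context (P : probability T R) (U : nat -> {RV P >-> R}).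

(** Cylinder events on the first [n] sample points: a pi-system generating their sigma-algebra, in
    the form to which mutual independence applies. *)
Definition past (n : nat) : set (set T) :=
  [set E | exists A : nat -> set R, (forall i, measurable (A i)) /\
    E = \bigcap_(i in [set` iota 0 n]) (U i @^-1` A i)].

Lemma past_measurable n : past n `<=` measurable.
Proof.
move=> _ [A [mA ->]]; apply: bigcap_measurableType => i _.
by rewrite -[X in measurable X]setTI; exact: measurable_funP.
Qed.

Lemma past_setI n : setI_closed (past n).
Proof.
move=> _ _ [A [mA ->]] [B [mB ->]]; exists (fun i => A i `&` B i); split.
  by move=> i; exact: measurableI.
rewrite -bigcapI; apply: eq_bigcapr => i _.
by rewrite preimage_setI.
Qed.

Lemma past_setT n : past n setT.
Proof.
exists (fun=> setT); split => //.
by apply/esym; rewrite -subTset => w _ i _.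
Qed.

Lemma past_preimage n i (D : set R) : (i < n)%N -> measurable D ->
  past n (U i @^-1` D).
Proof.
move=> ni mD; exists (fun j => if j == i then D else setT); split.
  by move=> j; case: ifP.
apply/seteqP; split=> w /=; last by move=> /(_ i) /=; rewrite eqxx mem_iota; apply.
by move=> Dw j _ /=; case: eqP => [->|].
Qed.

(** For fixed [D] both sides are finite measures of [E]. They agree on cylinders, hence on the
    generated sigma-algebra. *)
Lemma past_indep n E D : mutually_independent U -> <<s past n >> E ->
  measurable D -> P (E `&` U n @^-1` D) = (P E * P (U n @^-1` D))%E.
Proof.
move=> U_indep pE mD.
have mUD : measurable (U n @^-1` D).
  by rewrite -[X in measurable X]setTI; exact: measurable_funP.
have PD_ge0 : 0 <= fine (P (U n @^-1` D)) by exact: fine_ge0.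
pose m1 : {measure set T -> \bar R} := mrestr P mUD.
pose m2 : {measure set T -> \bar R} := mscale (NngNum PD_ge0) P.
have m2E A : m2 A = (P A * P (U n @^-1` D))%E.
  by rewrite /m2 /= /mscale /= muleC fineK // fin_num_measure.
rewrite -m2E -[LHS]/(m1 E).
apply: (g_sigma_algebra_measure_unique (past n) _ (fun=> setT)) => //.
- exact: past_measurable.
- by move=> _; exact: past_setT.
- by rewrite bigcup_const //; exists 0%N.
- exact: past_setI.
- move=> _ [A [mA ->]]; rewrite m2E /m1 /= /mrestr.
  (* Putting [D] at index [n] turns the intersection into a cylinder over [n.+1] indices. *)
  pose B i := if (i < n)%N then A i else D.
  have mB i : measurable (B i) by rewrite /B; case: ifP.
  have : P (\bigcap_(i in [set` iota 0 n.+1]) (U i @^-1` B i)) =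
         (\prod_(i <- iota 0 n.+1) P (U i @^-1` B i))%E.
    by apply: U_indep => //; exact: iota_uniq.
  rewrite -addn1 iotaD big_cat /= add0n big_seq1 {3}/B ltnn.
  have past_prod : (\prod_(i <- iota 0 n) P (U i @^-1` B i))%E =
                   P (\bigcap_(i in [set` iota 0 n]) (U i @^-1` A i)).
    rewrite (U_indep _ _ (iota_uniq 0 n) mA) big_seq [RHS]big_seq.
    by apply: eq_bigr => i; rewrite mem_iota /= add0n /B => ->.
  rewrite past_prod => <-; congr (P _); apply/seteqP; split => w /=.
    move=> [Aw Dw] i /=; rewrite mem_cat mem_iota add0n inE /= /B.
    by case: ifP => [ni _|_ /= /eqP -> //]; apply: Aw => /=; rewrite mem_iota.
  move=> Bw; split => [i|] /=.
    rewrite mem_iota add0n /= => ni; have := Bw i; rewrite /B ni; apply => /=.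
    by rewrite mem_cat mem_iota add0n ni.
  have := Bw n; rewrite /B ltnn; apply => /=.
  by rewrite mem_cat inE eqxx orbT.
- by move=> _; rewrite /m1 /= /mrestr setTI ltey_eq fin_num_measure.
Qed.

(** As [X] depends on the past only, the joint law of [X] and [U n] is the product of their laws.
    Tonelli then integrates over [X] with [t] held fixed. *)
Lemma integral_past_pair {d'} {T' : measurableType d'} (X : {mfun T >-> T'}) n
    (f : T' * R -> \bar R) : mutually_independent U ->
  (forall C, measurable C -> <<s past n >> (X @^-1` C)) ->
  measurable_fun setT f -> (forall z, 0 <= f z)%E ->
  (\int[P]_w f (X w, U n w) =
   \int[distribution P (U n)]_t \int[P]_w f (X w, t))%E.
Proof.
move=> U_indep pX mf f0.
have mXU : measurable_fun setT (fun w => (X w, U n w)).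
  by apply: measurable_fun_pair; exact: measurable_funP.
rewrite -[LHS](@ge0_integral_pushforward _ _ _ _ _ _ mXU P setT f) //.
pose XU : {mfun T >-> (T' * R)%type} :=
  HB.pack (fun w => (X w, U n w)) (isMeasurableFun.Build _ _ _ _ _ mXU).
transitivity (\int[distribution P X \x distribution P (U n)]_z f z)%E.
  apply: eq_measure_integral => C mC _; apply/esym.
  apply: (@product_measure_unique _ _ _ _ _ _ _ (distribution P XU)) => // A B mA mB.
  by rewrite /distribution /pushforward /= -past_indep //; apply: pX.
rewrite fubini_tonelli2 //; apply: eq_integral => t _.
rewrite /fubini_G ge0_integral_distribution //.
exact: measurableT_comp.
Qed.

Lemma lo_hi_past (alpha : R) n (C : set (R * R)) : measurable C ->
  <<s past n >> ((fun w => (lo alpha (U ^~ w) n, hi alpha (U ^~ w) n)) @^-1` C).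
Proof.
move=> mC.
(* The induction runs over [k] with [n] fixed, so that the sigma-algebra stays the same
   throughout. *)
suff H k : (k <= n)%N ->
    measurable_fun [set: g_sigma_algebraType (past n)] (fun w => lo alpha (U ^~ w) k) /\
    measurable_fun [set: g_sigma_algebraType (past n)] (fun w => hi alpha (U ^~ w) k).
  have [ml mh] := H n (leqnn n).
  by have := measurable_fun_pair ml mh measurableT mC; rewrite setTI.
elim: k => [|k IH] kn.
  split; exact: measurable_cst.
have [ml mh] := IH (ltnW kn).
have mU : measurable_fun [set: g_sigma_algebraType (past n)] (U k).
  move=> _ D mD; rewrite setTI; apply: sub_sigma_algebra.
  exact: past_preimage.
split.
  apply: measurable_maxr => //.
  by apply: (measurableT_comp (measurable_below alpha)).
apply: measurable_minr => //.
by apply: (measurableT_comp (measurable_above alpha)).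
Qed.

Lemma measurable_lo_hi (alpha : R) n :
  measurable_fun setT (fun w => (lo alpha (U ^~ w) n, hi alpha (U ^~ w) n)).
Proof.
move=> _ C mC; rewrite setTI; have := lo_hi_past alpha n C mC.
apply: smallest_sub; last exact: past_measurable.
exact: sigma_algebra_measurable.
Qed.

End past_independence.

(** * Integration lemmas *)

Section unmeasured.
Context {R : realType} {d : measure_display} {T : measurableType d}.
Context (mu : {measure set T -> \bar R}) (N : set T) (f g : T -> \bar R).

Import HBNNSimple.

(* The integral is a supremum over simple functions, so that f need not be
   measurable on N. *)
Lemma ge0_integral_eq_off_null : measurable N -> mu N = 0%E ->
  (forall x, 0 <= f x)%E -> (forall x, 0 <= g x)%E -> measurable_fun setT g ->
  (forall x, ~ N x -> f x = g x) -> (\int[mu]_x f x = \int[mu]_x g x)%E.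
Proof.
move=> mN N0 f0 g0 mg fg.
have mNC : measurable (~` N) by exact: measurableC.
have off (h : T -> \bar R) : (forall x, 0 <= h x)%E -> measurable_fun setT h ->
    (\int[mu]_x h x = \int[mu]_x (h \_ (~` N)) x)%E.
  move=> h0 mh; rewrite (ge0_negligible_integral mN) // setTD.
  by rewrite integral_mkcond.
(* Upper bound: a simple function below [f], set to 0 on [N], lies below [g]. Lower bound: a simple
   function below [g] cut to 0 on [N] lies below [f] everywhere. *)
apply/eqP; rewrite eq_le; apply/andP; split.
  rewrite ge0_integralTE //; apply: ge_ereal_sup => _ [h /= hf <-].
  have mh : measurable_fun setT (EFin \o h) by exact/measurable_EFinP.
  rewrite -integralT_nnsfun (off (EFin \o h)) //; last first.
    by move=> x; rewrite lee_fin.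
  apply: ge0_le_integral => //.
  - by move=> x _; apply: erestrict_ge0 => y _; rewrite lee_fin.
  - exact/(measurable_restrictT _ mNC)/measurable_funTS.
  - move=> x _; rewrite patchE; case: ifPn => [/set_mem Nx|_]; last exact: g0.
    by rewrite -fg //=; exact: hf.
rewrite off // ge0_integralTE; last by move=> x; exact: erestrict_ge0.
rewrite [leRHS]ge0_integralTE //.
apply: ereal_sup_le => _ [h /= hg <-].
exists h => // x; apply: (le_trans (hg x)).
by rewrite patchE; case: ifPn => [/set_mem Nx|_]; [rewrite fg|exact: f0].
Qed.

End unmeasured.

(* Borel sets of R carry two convertible displays in the library; the push
   forward along the identity moves between them. *)
Lemma integral_uniform01 {R : realType} {d : measure_display}
    {T : measurableType d} (P : probability T R) (X : {RV P >-> R})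
    (f : R -> \bar R) :
  uniform01 X -> measurable_fun setT f -> (forall x, 0 <= f x)%E ->
  (\int[distribution P X]_t f t =
   \int[lebesgue_measure]_(t in `[0%R, 1%R]) f t)%E.
Proof.
move=> UX mf f0.
have mid : measurable_fun setT (idfun : measurableTypeR R -> R).
  by move=> _ A mA; rewrite setTI.
transitivity (\int[pushforward (uniform_prob (@ltr01 R))
                (idfun : measurableTypeR R -> R)]_t f t)%E.
  by apply: eq_measure_integral => A mA _; exact: UX.
rewrite ge0_integral_pushforward // [LHS]integral_uniform //.
by rewrite subr0 invr1 mul1e.
Qed.

Lemma plane_integral12 {R : realType} (f : R * R -> \bar R) :
  measurable_fun setT f -> (forall z, 0 <= f z)%E ->
  (\int[lebesgue_measure \x lebesgue_measure]_z f z =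
   \int[lebesgue_measure]_x \int[lebesgue_measure]_t f (x, t))%E.
Proof. by move=> mf f0; exact: fubini_tonelli1. Qed.

Lemma plane_integral21 {R : realType} (f : R * R -> \bar R) :
  measurable_fun setT f -> (forall z, 0 <= f z)%E ->
  (\int[lebesgue_measure \x lebesgue_measure]_z f z =
   \int[lebesgue_measure]_t \int[lebesgue_measure]_x f (x, t))%E.
Proof. by move=> mf f0; exact: fubini_tonelli2. Qed.

(** The plane splits into two half-planes and the diagonal. Tonelli in opposite orders exchanges the
    half-planes, and the diagonal is null because each of its sections is a point. *)
Lemma ge0_integral_sym {R : realType} (S : R * R -> \bar R) :
  measurable_fun setT S -> (forall z, 0 <= S z)%E ->
  (forall x t, S (x, t) = S (t, x)) ->
  (\int[lebesgue_measure \x lebesgue_measure]_z S z =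
   2%:E * \int[lebesgue_measure \x lebesgue_measure]_(z in
            [set z : R * R | (z.1 < z.2)%R]) S z)%E.
Proof.
move=> mS S0 Ssym.
pose lt := [set z : R * R | z.1 < z.2]; pose gt := [set z : R * R | z.2 < z.1].
pose diag := [set z : R * R | z.1 == z.2].
have mlt : measurable lt.
  have := measurable_fun_ltr (@measurable_fst _ _ R R) (@measurable_snd _ _ R R).
  by move=> /(_ measurableT [set true] I); rewrite setTI.
have mgt : measurable gt.
  have := measurable_fun_ltr (@measurable_snd _ _ R R) (@measurable_fst _ _ R R).
  by move=> /(_ measurableT [set true] I); rewrite setTI.
have mdiag : measurable diag.
  have := measurable_fun_eqr (@measurable_fst _ _ R R) (@measurable_snd _ _ R R).
  by move=> /(_ measurableT [set true] I); rewrite setTI.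
have mSr (D : set (R * R)) : measurable D -> measurable_fun setT (S \_ D).
  by move=> mD; apply/(measurable_restrictT _ mD)/measurable_funTS.
have Sr0 (D : set (R * R)) z : (0 <= (S \_ D) z)%E by exact: erestrict_ge0.
have -> : (\int[lebesgue_measure \x lebesgue_measure]_z S z)%E =
    (\int[lebesgue_measure \x lebesgue_measure]_(z in (lt `|` gt) `|` diag) S z)%E.
  congr integral; apply/esym; rewrite -subTset => -[x t] _ /=.
  by rewrite /lt /gt /diag /=; case: (ltgtP x t); [left; left|left; right|right].
rewrite ge0_integral_setU //=; first last.
- rewrite disj_set2E; apply/eqP; rewrite -subset0 => -[x t] [+ /eqP /= xt].
  by rewrite /lt /gt /= xt !ltxx => -[].
- exact: measurable_funTS.
- exact: measurableU.
rewrite ge0_integral_setU //=; first last.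
- rewrite disj_set2E; apply/eqP; rewrite -subset0 => -[x t] [/= xt tx].
  by move: (lt_trans xt tx); rewrite ltxx.
- exact: measurable_funTS.
have -> : (\int[lebesgue_measure \x lebesgue_measure]_(z in gt) S z =
           \int[lebesgue_measure \x lebesgue_measure]_(z in lt) S z)%E.
  rewrite integral_mkcond [RHS]integral_mkcond.
  rewrite (plane_integral12 _ (mSr _ mgt) (Sr0 gt)).
  rewrite (plane_integral21 _ (mSr _ mlt) (Sr0 lt)).
  apply: eq_integral => x _; apply: eq_integral => t _.
  by rewrite !patchE Ssym; congr (if _ then _ else _).
have -> : (\int[lebesgue_measure \x lebesgue_measure]_(z in diag) S z = 0)%E.
  rewrite integral_mkcond (plane_integral12 _ (mSr _ mdiag) (Sr0 diag)).
  apply: integral0_eq => x _.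
  rewrite -(integral_set1 (fun t => S (x, t)) x) [RHS]integral_mkcond.
  apply: eq_integral => t _; rewrite !patchE; congr (if _ then _ else _).
  apply/idP/idP => /set_mem H; apply/mem_set; first by apply/esym/eqP.
  by apply/eqP.
by rewrite adde0 -mule2n mule_natl.
Qed.

Lemma nneseries_geometric {R : realType} (a q : R) : 0 <= q < 1 ->
  (\sum_(n <oo) (a * q ^+ n)%:E = (a * (1 - q)^-1)%:E)%E.
Proof.
move=> /andP[q0 q1]; apply/cvg_lim => //.
under eq_fun do rewrite sumEFin.
apply: cvg_EFin; first exact: nearW.
by apply: cvg_geometric_series; rewrite ger0_norm.
Qed.

(** * The expected cost *)

Lemma uniform_prob01 {R : realType} (A : set R) : measurable A ->
  A `<=` `[0, 1] -> uniform_prob (@ltr01 R) A = lebesgue_measure A.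
Proof.
move=> mA A01; rewrite /uniform_prob (eq_integral (cst 1%E)); last first.
  move=> x /set_mem /A01 /=; rewrite in_itv /= /uniform_pdf => ->.
  by rewrite subr0 invr1.
by rewrite integral_cst // mul1e.
Qed.

(** * Probability that two given points both stay in the interval *)

Section straddle.
Context {R : realType} (alpha : R).
Hypothesis alpha01 : 0 <= alpha <= 1.

(** The length of the hull of [alpha], [x] and [t], written p in the overview. *)
Definition straddle (x t : R) : R :=
  Num.max alpha (Num.max x t) - Num.min alpha (Num.min x t).

(** The sample values that remove neither [x] nor [t]. Phrased through [below] and [above], it also
    admits values outside ]0, 1[, so that [lo_hi_noncut] holds for every sequence. *)
Definition noncut (x t : R) : set R :=
  [set v | below alpha v < Num.min x t /\ Num.max x t < above alpha v].

(** The default values 0 and 1 never cut, since [x] and [t] lie strictly between them. Either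
    interval may be empty. *)
Lemma noncutC x t : 0 < x < 1 -> 0 < t < 1 -> ~` noncut x t =
  `[Num.min x t, alpha[ `|` `]alpha, Num.max x t].
Proof.
move=> /andP[x0 x1] /andP[t0 t1].
have m0 : 0 < Num.min x t by rewrite lt_min x0.
have M1 : Num.max x t < 1 by rewrite gt_max x1.
apply/seteqP; split => v /=; rewrite !in_itv /= /noncut /below /above /=.
  move=> /not_andP[|] /negP; rewrite -leNgt; case: ifPn => /=.
  - by move=> /andP[_ va] mv; left; rewrite mv.
  - by move=> _ /(lt_le_trans m0); rewrite ltxx.
  - by move=> /andP[av _] vM; right; rewrite av.
  - by move=> _ /le_lt_trans /(_ M1); rewrite ltxx.
move=> [/andP[mv va]|/andP[av vM]] [].
  by rewrite (lt_le_trans m0 mv) va /= ltNge mv.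
by move=> _; rewrite (le_lt_trans vM M1) av /= ltNge vM.
Qed.

Lemma measurable_noncut x t : 0 < x < 1 -> 0 < t < 1 ->
  measurable (noncut x t).
Proof.
move=> x01 t01; rewrite -[X in measurable X]setCK noncutC //.
by apply: measurableC; apply: measurableU; exact: measurable_itv.
Qed.

Lemma straddle_itv x t : 0 < x < 1 -> 0 < t < 1 -> 0 <= straddle x t <= 1.
Proof.
move=> /andP[x0 x1] /andP[t0 t1]; case/andP: alpha01 => a0 a1.
rewrite /straddle; apply/andP; split.
  by rewrite subr_ge0 ge_min le_max lexx.
rewrite lerBlDl -[leLHS]add0r lerD //.
  by rewrite !le_min a0 !ltW.
by rewrite !ge_max a1 !ltW.
Qed.

Lemma uniform_noncut x t : 0 < x < 1 -> 0 < t < 1 ->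
  uniform_prob (@ltr01 R) (noncut x t) = (1 - straddle x t)%:E.
Proof.
move=> x01 t01; have mQ := measurable_noncut x t x01 t01.
have mL : measurable (`[Num.min x t, alpha[ : set R) by exact: measurable_itv.
have mR : measurable (`]alpha, Num.max x t] : set R) by exact: measurable_itv.
suff : uniform_prob (@ltr01 R) (~` noncut x t) = (straddle x t)%:E.
  move=> pE; rewrite -[noncut x t]setCK [LHS]probability_setC.
    by rewrite [X in (_ - X)%E]pE.
  exact: measurableC.
rewrite noncutC // uniform_prob01; first last.
- case/andP: alpha01 => a0 a1; case/andP: x01 => x0 x1; case/andP: t01 => t0 t1.
  have m0 : 0 < Num.min x t by rewrite lt_min x0.
  have M1 : Num.max x t < 1 by rewrite gt_max x1.
  move=> v /=; rewrite !in_itv /= => -[/andP[mv va]|/andP[av vM]].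
    by rewrite (le_trans (ltW m0) mv) (le_trans (ltW va) a1).
  by rewrite (le_trans a0 (ltW av)) (le_trans vM (ltW M1)).
- exact: measurableU.
transitivity (lebesgue_measure (`[Num.min x t, alpha[ : set R) +
              lebesgue_measure (`]alpha, Num.max x t] : set R))%E.
  apply: measureU => //; apply/seteqP; split => v //=; rewrite !in_itv /=.
  by move=> -[/andP[_ va] /andP[av _]]; move: (lt_trans va av); rewrite ltxx.
(* With m and M the minimum and maximum of [x] and [t], the lengths are the positive parts of alpha
   - m and M - alpha. Their sum is the hull length in each of the four cases. *)
rewrite !lebesgue_measure_itv /= !lte_fin /straddle.
have mM : Num.min x t <= Num.max x t by rewrite ge_min le_max lexx.
move: (Num.min x t) (Num.max x t) mM => m M mM.
case: ltP => [ma|am]; case: ltP => [aM|Ma].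
- by rewrite -!EFinD [alpha - m + _]addrC addrA subrK.
- by rewrite adde0.
- by rewrite add0e.
- by rewrite subrr adde0.
Qed.

Lemma lo_hi_noncut u x t n : 0 < x < 1 -> 0 < t < 1 ->
  (lo alpha u n < Num.min x t /\ Num.max x t < hi alpha u n) <->
  forall i, (i < n)%N -> noncut x t (u i).
Proof.
move=> /andP[x0 x1] /andP[t0 t1].
elim: n => [|n IH] /=; first by rewrite lt_min x0 t0 gt_max x1 t1.
rewrite [Num.max (lo _ _ _) _ < _]gt_max [_ < Num.min (hi _ _ _) _]lt_min; split.
  move=> [/andP[ln bn] /andP[hn an]] i; rewrite ltnS leq_eqVlt.
  by case/predU1P => [->//|]; exact: (IH.1 (conj ln hn)).
move=> H; have [bn an] := H n (ltnSn n); rewrite bn an !andbT; apply/IH => i ni.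
by apply: H; exact: ltnW.
Qed.

Context {d : measure_display} {T : measurableType d}.
Context (P : probability T R) (U : nat -> {RV P >-> R}).

(** The event is a cylinder with the same base [noncut x t] at each of the first [n] indices, so
    independence gives a power. *)
Lemma prob_straddled x t n : (forall i, uniform01 (U i)) ->
  mutually_independent U -> 0 < x < 1 -> 0 < t < 1 ->
  P [set w | lo alpha (U ^~ w) n < Num.min x t /\
             Num.max x t < hi alpha (U ^~ w) n] =
  ((1 - straddle x t) ^+ n)%:E.
Proof.
move=> U_uniform U_indep x01 t01.
have mQ := measurable_noncut x t x01 t01.
have -> : [set w | lo alpha (U ^~ w) n < Num.min x t /\
                   Num.max x t < hi alpha (U ^~ w) n] =
          \bigcap_(i in [set` iota 0 n]) (U i @^-1` noncut x t).
  apply/seteqP; split => w /=.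
    move=> /(lo_hi_noncut (U ^~ w) x t n x01 t01) H i /=.
    by rewrite mem_iota add0n; exact: H.
  move=> H; apply/(lo_hi_noncut (U ^~ w) x t n x01 t01) => i ni.
  by apply: (H i); rewrite /= mem_iota add0n.
rewrite (U_indep _ (fun=> noncut x t)) ?iota_uniq //.
under eq_bigr => i _.
  rewrite -[P _]/(distribution P (U i) (noncut x t)) U_uniform // uniform_noncut //.
  over.
elim: n => [|n IH]; first by rewrite big_nil expr0.
by rewrite -addn1 iotaD big_cat big_seq1 IH addn1 exprSr EFinM.
Qed.

End straddle.

(** * Expectation of one term, then of the series *)

Section expectation.
Context {R : realType} {d : measure_display} {T : measurableType d}.
Context (P : probability T R) (U : nat -> {RV P >-> R}).
Context (alpha : R) (beta : R -> R -> R).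
Hypotheses (U_uniform : forall i, uniform01 (U i))
  (U_indep : mutually_independent U) (alpha01 : 0 <= alpha <= 1).
Hypotheses
  (beta_ge0 : forall u t : R, 0 < u < 1 -> 0 < t < 1 -> 0 <= beta u t)
  (beta_sym : forall u t : R, 0 < u < 1 -> 0 < t < 1 -> beta u t = beta t u)
  (beta_meas : measurable_fun (`]0, 1[ `*` `]0, 1[ : set (R * R))
                 (fun z : R * R => beta z.1 z.2)).

(** Extension of [beta] by zero: nonnegativity, symmetry and measurability, assumed on the unit
    square, then hold on the whole plane. *)
Let b : R * R -> R := (fun z => beta z.1 z.2) \_ (`]0, 1[ `*` `]0, 1[).

Let bE x t : 0 < x < 1 -> 0 < t < 1 -> b (x, t) = beta x t.
Proof.
by move=> x01 t01; rewrite /b patchE mem_set //=; split; rewrite /= in_itv.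
Qed.

Let b_out x t : ~~ ((0 < x < 1) && (0 < t < 1)) -> b (x, t) = 0.
Proof.
move=> out; rewrite /b patchE ifF //; apply: contraNF out.
by move=> /set_mem [] /=; rewrite !in_itv /= => -> ->.
Qed.

Let b_ge0 z : 0 <= b z.
Proof.
case: z => x t; have [/andP[x01 t01]|out] := boolP ((0 < x < 1) && (0 < t < 1)).
  by rewrite bE // beta_ge0.
by rewrite b_out.
Qed.

Let b_sym x t : b (x, t) = b (t, x).
Proof.
have [/andP[x01 t01]|out] := boolP ((0 < x < 1) && (0 < t < 1)).
  by rewrite !bE // beta_sym.
by rewrite !b_out // andbC.
Qed.

Let measurable_b : measurable_fun setT b.
Proof.
have m01 : measurable (`]0, 1[ : set R) by exact: measurable_itv.
exact/(measurable_restrictT _ (measurableX m01 m01)).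
Qed.

(** The arguments are x, the interval ends and t. The variable x comes first so that integrating it
    out leaves a measurable function of the rest. *)
Let slice (y : R * ((R * R) * R)) : \bar R :=
  (if [&& y.2.1.1 < y.1, y.1 < y.2.1.2, y.2.1.1 < y.2.2 & y.2.2 < y.2.1.2]
   then b (y.1, y.2.2) else 0)%:E.

Let slice_ge0 y : (0 <= slice y)%E.
Proof. by rewrite /slice lee_fin; case: ifP. Qed.

Let measurable_slice : measurable_fun setT slice.
Proof.
have mx : measurable_fun setT (fun y : R * ((R * R) * R) => y.1).
  exact: measurable_fst.
have mq : measurable_fun setT (fun y : R * ((R * R) * R) => y.2).
  exact: measurable_snd.
have mt : measurable_fun setT (fun y : R * ((R * R) * R) => y.2.2).
  by apply: (measurableT_comp _ mq); exact: measurable_snd.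
have mlh : measurable_fun setT (fun y : R * ((R * R) * R) => y.2.1).
  by apply: (measurableT_comp _ mq); exact: measurable_fst.
have ml : measurable_fun setT (fun y : R * ((R * R) * R) => y.2.1.1).
  by apply: (measurableT_comp _ mlh); exact: measurable_fst.
have mh : measurable_fun setT (fun y : R * ((R * R) * R) => y.2.1.2).
  by apply: (measurableT_comp _ mlh); exact: measurable_snd.
apply/measurable_EFinP; apply: measurable_fun_ifT => //.
  by do 3 (apply: measurable_and; first exact: measurable_fun_ltr);
     exact: measurable_fun_ltr.
by apply: (measurableT_comp measurable_b); exact: measurable_fun_pair.
Qed.

Let measurable_sliced : measurable_fun setT
  (fun z : (R * R) * R => \int[lebesgue_measure]_x slice (x, z))%E.
Proof.
exact: (measurable_fun_fubini_tonelli_G (m1 := lebesgue_measure) slice).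
Qed.

(** The moving domain of integration becomes an indicator, which makes the cost a fixed measurable
    function of the extremes and [u n]. *)
Let time_costE u n : time_cost alpha beta u n =
  (\int[lebesgue_measure]_x slice (x, ((lo alpha u n, hi alpha u n), u n)))%E.
Proof.
have /andP[l0 _] := lo_itv alpha alpha01 u n.
have /andP[_ h1] := hi_itv alpha alpha01 u n.
rewrite /time_cost /slice /=; case: ifPn => [/andP[lu uh]|_].
  rewrite integral_mkcond; apply: eq_integral => x _.
  rewrite patchE !andbT.
  rewrite (_ : (x \in _) = (lo alpha u n < x < hi alpha u n)); last first.
    by apply/idP/idP => [/set_mem|H]; last apply/mem_set; rewrite /= in_itv.
  case: ifPn => // /andP[lx xh].
  by rewrite bE ?(le_lt_trans l0 lx) ?(lt_le_trans xh h1) //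
     (le_lt_trans l0 lu) (lt_le_trans uh h1).
by rewrite integral0_eq // => x _; rewrite !andbF.
Qed.

(** The cost density times the probability that both points survive the first [n] samples. *)
Let weight n (z : R * R) : \bar R :=
  (b z * (1 - straddle alpha z.1 z.2) ^+ n)%:E.

Let weight_ge0 n z : (0 <= weight n z)%E.
Proof.
case: z => x t; rewrite /weight lee_fin /=.
have [/andP[x01 t01]|out] := boolP ((0 < x < 1) && (0 < t < 1)).
  rewrite mulr_ge0 // exprn_ge0 // subr_ge0.
  by case/andP: (straddle_itv alpha alpha01 x t x01 t01).
by rewrite b_out // mul0r.
Qed.

Let measurable_weight n : measurable_fun setT (weight n).
Proof.
have mx := @measurable_fst _ _ R R; have mt := @measurable_snd _ _ R R.
apply/measurable_EFinP; apply: measurable_funM => //.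
apply: measurable_funX; apply: measurable_funB => //.
apply: measurable_funB.
  by apply: measurable_maxr => //; exact: measurable_maxr.
by apply: measurable_minr => //; exact: measurable_minr.
Qed.

Let mLH n : measurable_fun setT
    (fun w => (lo alpha (U ^~ w) n, hi alpha (U ^~ w) n)).
Proof. exact: measurable_lo_hi. Qed.

Let LH n : {mfun T >-> (R * R)%type} :=
  HB.pack (fun w => (lo alpha (U ^~ w) n, hi alpha (U ^~ w) n))
          (isMeasurableFun.Build _ _ _ _ _ (mLH n)).

Let measurable_time_cost n :
  measurable_fun setT (fun w => time_cost alpha beta (U ^~ w) n).
Proof.
under eq_fun do rewrite time_costE.
apply: (measurableT_comp measurable_sliced).
by apply: measurable_fun_pair => //; exact: mLH.
Qed.

(** Independence allows [U n] to be frozen at [t]. Tonelli then puts the expectation inside the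
    x-integral, where it meets only an indicator. *)
Lemma expected_time_cost n :
  (\int[P]_w time_cost alpha beta (U ^~ w) n =
   \int[lebesgue_measure \x lebesgue_measure]_z weight n z)%E.
Proof.
under eq_integral do rewrite time_costE.
rewrite (integral_past_pair P U (LH n) n
  (fun z => \int[lebesgue_measure]_x slice (x, z))%E) //; first last.
- by move=> z; exact: integral_ge0.
- by move=> C mC; exact: lo_hi_past.
have sliceE t : (\int[P]_w \int[lebesgue_measure]_x slice (x, (LH n w, t)) =
    \int[lebesgue_measure]_x weight n (x, t))%E.
  transitivity (\int[lebesgue_measure]_x \int[P]_w slice (x, (LH n w, t)))%E.
    apply: (fubini_tonelli (m1 := P) (m2 := lebesgue_measure)
      (fun z => slice (z.2, (LH n z.1, t)))) => //.
    apply: (measurableT_comp measurable_slice); apply: measurable_fun_pair => //.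
    apply: measurable_fun_pair => //.
    by apply: (measurableT_comp (mLH n)); exact: measurable_fst.
  apply: eq_integral => x _ /=.
  have [/andP[x01 t01]|out] := boolP ((0 < x < 1) && (0 < t < 1)); last first.
    rewrite /weight b_out // mul0r; apply: integral0_eq => w _.
    by rewrite /slice /= b_out // if_same.
  pose E := [set w | lo alpha (U ^~ w) n < Num.min x t /\
                     Num.max x t < hi alpha (U ^~ w) n].
  have mE : measurable E.
    have := mLH n measurableT ([set y | y < Num.min x t] `*` [set y | Num.max x t < y]).
    rewrite setTI; apply; apply: measurableX.
      by rewrite -set_itvNyo; exact: measurable_itv.
    by rewrite -set_itvoy; exact: measurable_itv.
  (* The four comparisons in [slice] say exactly that [w] lies in [E]. *)
  transitivity (\int[P]_w ((b (x, t))%:E * (\1_E w)%:E))%E.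
    apply: eq_integral => w _; rewrite /slice /= indicE -EFinM; congr EFin.
    rewrite (_ : (w \in E) = [&& lo alpha (U ^~ w) n < x, x < hi alpha (U ^~ w) n,
        lo alpha (U ^~ w) n < t & t < hi alpha (U ^~ w) n]).
      by case: ifP => _; rewrite ?mulr1 ?mulr0.
    apply/idP/idP => [/set_mem []|/and4P[lx xh lt th]].
      by rewrite lt_min gt_max => /andP[-> ->] /andP[-> ->].
    by apply/mem_set; split; rewrite ?lt_min ?gt_max ?lx ?xh ?lt ?th.
  rewrite ge0_integralZl //; last 2 first.
  - exact/measurable_EFinP/measurable_indic.
  - by rewrite lee_fin.
  rewrite integral_indic // setIT.
  by rewrite [X in (_ * X)%E](prob_straddled alpha alpha01 P U x t n).
under eq_integral do rewrite sliceE.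
have mK : measurable_fun setT
    (fun t => \int[lebesgue_measure]_x weight n (x, t))%E.
  exact: (measurable_fun_fubini_tonelli_G (m1 := lebesgue_measure) _
    (measurable_weight n) (weight_ge0 n)).
(* The law of [U n] becomes Lebesgue measure on [0, 1]; extending to the whole line adds nothing, as
   [b] vanishes there. *)
rewrite integral_uniform01 //; last by move=> t; exact: integral_ge0.
rewrite plane_integral21 // integral_mkcond.
apply: eq_integral => t _; rewrite patchE; case: ifPn => // tout.
rewrite integral0_eq // => x _; rewrite /weight b_out ?mul0r //.
apply: contra tout => /andP[_ /andP[t0 t1]].
by apply/mem_set; rewrite /= in_itv /= !ltW.
Qed.

(** For x < t the hull has positive length, so the ratio 1 - p is below 1. At x = t = alpha the
    ratio would be 1. *)
Let sum_weight z : z.1 < z.2 ->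
  (\sum_(n <oo) weight n z = (b z * (straddle alpha z.1 z.2)^-1)%:E)%E.
Proof.
case: z => x t /= xt.
have [/andP[x01 t01]|out] := boolP ((0 < x < 1) && (0 < t < 1)).
  rewrite nneseries_geometric ?subKr //.
  case/andP: (straddle_itv alpha alpha01 x t x01 t01) => _ s1.
  rewrite subr_ge0 s1 /= ltrBlDl ltrDr /straddle subr_gt0.
  by rewrite (max_idPr (ltW xt)) (min_idPl (ltW xt)) gt_min !lt_max xt !orbT.
rewrite b_out // mul0r; apply: eseries0 => n _ _.
by rewrite /weight b_out // mul0r.
Qed.

Lemma expected_total_cost :
  (\int[P]_w total_cost alpha beta (U ^~ w) =
   2%:E * \int[lebesgue_measure \x lebesgue_measure]_(z in
             [set z : R * R | [/\ (0 < z.1)%R, (z.1 < z.2)%R & (z.2 < 1)%R]])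
     (beta z.1 z.2 * (Num.max alpha z.2 - Num.min alpha z.1)^-1)%:E)%E.
Proof.
have tc0 n w : (0 <= time_cost alpha beta (U ^~ w) n)%E.
  exact: time_cost_ge0.
have PU0 n : P (U n @^-1` [set alpha]) = 0%E.
  rewrite -[LHS]/(distribution P (U n) [set alpha]) U_uniform //.
  by rewrite /uniform_prob integral_set1.
pose N := \bigcup_n (U n @^-1` [set alpha]).
have mU n : measurable (U n @^-1` [set alpha]).
  by rewrite -[X in measurable X]setTI; exact: measurable_funP.
have mN : measurable N by exact: bigcupT_measurable.
(* Rounds and sample points are matched only off the null event [N] that some point equals
   [alpha]. *)
rewrite (ge0_integral_eq_off_null P N _
  (fun w => \sum_(0 <= n <oo) time_cost alpha beta (U ^~ w) n)%E); first last.
- move=> w Nw; apply: total_cost_time => // i; apply/eqP => Ui.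
  by apply: Nw; exists i.
- exact: ge0_emeasurable_sum.
- by move=> w; exact: nneseries_ge0.
- by move=> w; apply: nneseries_ge0 => k _ _; exact: round_cost_ge0.
- apply/eqP; rewrite eq_le measure_ge0 andbT.
  have /(_ (@subset_refl _ N)) := measure_sigma_subadditive P mU mN.
  by rewrite (eq_eseriesr (fun n _ => PU0 n)) eseries0.
- by [].
(* Nonnegativity lets the series leave the expectation and, once each term is computed, enter the
   plane integral. *)
rewrite integral_nneseries //.
under eq_eseriesr do rewrite expected_time_cost.
rewrite -integral_nneseries // ge0_integral_sym; first last.
- move=> x t; apply: eq_eseriesr => n _.
  by rewrite /weight /= b_sym /straddle [Num.max x t]maxC [Num.min x t]minC.
- by move=> z; exact: nneseries_ge0.
- exact: ge0_emeasurable_sum.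
(* The half-plane x < t reduces to the triangle because [b] vanishes off the unit square. *)
congr (_ * _)%E; rewrite integral_mkcond [RHS]integral_mkcond.
apply: eq_integral => -[x t] _; rewrite !patchE.
case: ifPn => [/set_mem xt|xt]; last first.
  rewrite ifF //; apply: contraNF xt => /set_mem [] _ xt _.
  exact/mem_set.
rewrite sum_weight //=; case: ifPn => [/set_mem [/= x0 _ t1]|out].
  have x01 : 0 < x < 1 by rewrite x0 (lt_trans xt).
  have t01 : 0 < t < 1 by rewrite t1 (lt_trans x0).
  by rewrite bE // /straddle (max_idPr (ltW xt)) (min_idPl (ltW xt)).
rewrite b_out ?mul0r //; apply: contra out => /andP[/andP[x0 _] /andP[_ t1]].
exact/mem_set.
Qed.

End expectation.

Theorem theorem3p8 (R : realType) (d : measure_display) (T : measurableType d)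
  (P : probability T R) (U : nat -> {RV P >-> R})
  (U_uniform : forall i, uniform01 (U i))
  (U_indep : mutually_independent U)
  (alpha : R) (alpha01 : 0 <= alpha <= 1)
  (beta : R -> R -> R)
  (beta_ge0 : forall u t : R, 0 < u < 1 -> 0 < t < 1 -> 0 <= beta u t)
  (beta_sym : forall u t : R, 0 < u < 1 -> 0 < t < 1 -> beta u t = beta t u)
  (beta_meas : measurable_fun (`]0, 1[ `*` `]0, 1[ : set (R * R))
                 (fun z : R * R => beta z.1 z.2)) :
  (\int[P]_w total_cost alpha beta (fun i => U i w) =
   2%:E * \int[lebesgue_measure \x lebesgue_measure]_(z in
             [set z : R * R | [/\ (0 < z.1)%R, (z.1 < z.2)%R & (z.2 < 1)%R]])
     (beta z.1 z.2 * (Num.max alpha z.2 - Num.min alpha z.1)^-1)%:E)%E.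
Proof. exact: expected_total_cost. Qed.
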